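(* Let $L_{\mathcal L}\subseteq\{0,1\}^*$ be the set of all binary words that are Lyndon words with respect to $0<1$, together with all words obtained from these by exchanging $0$ and $1$. Then $\mathcal G_{\{w\in L_{\mathcal L}\,\mid\,|w|\text{ is odd}\}}$ is exactly the class of bipartite graphs.
   Context: A word is primitive if it is not of the form $u^k$ with $k\ge2$. A Lyndon word is a primitive word that is lexicographically smallest among its conjugates (the conjugates of $uv$ are the words $vu$). A graph $G=(V,E)$ is bipartite if $V$ is the disjoint union of two (possibly empty) sets each containing no edge. Graphs are finite, undirected and simple: $G=(V,E)$ with $V$ a finite non-empty set and $E\subseteq\binom{V}{2}$. A language $L\subseteq\{0,1\}^*$ is $0$-$1$-symmetric if it is invariant under the morphism exchanging $0$ and $1$ (the language here is). For distinct letters $u,v$ of an alphabet $V$, $h_{u,v}:V^*\to\{0,1\}^*$ is the monoid morphism with $u\mapsto 0$, $v\mapsto 1$, and $x\mapsto\lambda$ (empty word) for all other letters $x$. For a $0$-$1$-symmetric $L$ and a word $w\in V^*$ in which every letter of $V$ occurs, $G(L,w)$ is the graph with vertex set $V$ in which distinct $u,v$ are adjacent if and only if $h_{u,v}(w)\in L$. $\mathcal G_L$ is the class of all graphs $G=(V,E)$ with $G=G(L,w)$ for some $w\in V^*$ in which every letter of $V$ occurs. *)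

(* Defs.v *)
From mathcomp Require Import all_boot all_order.

Set Implicit Arguments.
Unset Strict Implicit.
Unset Printing Implicit Defensive.

(** Binary words: the letters 0 and 1 are [false] and [true]. *)

Definition bword : Type := seq bool.

Definition language : Type := bword -> Prop.

Definition swap01 (w : bword) : bword := map negb w.

Definition sym01 (L : language) : Prop := forall w, L w <-> L (swap01 w).

(** The empty word is not primitive, as it equals its own powers. *)
Definition primitive (w : bword) : Prop :=
  ~ exists (u : bword) (k : nat), 2 <= k /\ w = flatten (nseq k u).

Definition conjugate (w w' : bword) : Prop :=
  exists u v : bword, w = u ++ v /\ w' = v ++ u.

(** [seqlexi bool] is [seq bool] with the lexicographic (dictionary) order
    induced by [false < true]; a proper prefix is smaller. *)
Definition lexle (w w' : bword) : bool :=
  ((w : seqlexi bool) <= (w' : seqlexi bool))%O.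

Definition lyndon (w : bword) : Prop :=
  primitive w /\ forall w', conjugate w w' -> lexle w w'.

Definition lyndon_lang : language := fun w => lyndon w \/ lyndon (swap01 w).

Definition odd_part (L : language) : language := fun w => L w /\ odd (size w).

Lemma sym01_odd_lyndon : sym01 (odd_part lyndon_lang).
Proof.
move=> w; rewrite /odd_part /lyndon_lang /swap01 size_map (mapK negbK).
by split=> -[[Hw|Hw] Ho]; split=> //; [right|left|right|left].
Qed.

Record graph : Type := Graph {
  vertex :> finType;
  adj : rel vertex;
  graph_nonempty : 0 < #|vertex|;
  adj_sym : symmetric adj;
  adj_irrefl : irreflexive adj
}.

Definition no_edge_in (G : graph) (A : {set G}) : Prop :=
  forall x y : G, x \in A -> y \in A -> ~~ adj x y.

Definition bipartite (G : graph) : Prop :=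
  exists A B : {set G},
    [/\ A :|: B = setT, [disjoint A & B], no_edge_in A & no_edge_in B].

Definition hmor (V : eqType) (u v : V) (w : seq V) : bword :=
  flatten [seq (if x == u then [:: false]
                else if x == v then [:: true] else [::]) | x <- w].

(** [G] is G(L, w).  The right-hand side is independent of the order of
    [u] and [v] when [sym01 L] holds. *)
Definition is_word_graph (L : language) (G : graph) (w : seq G) : Prop :=
  (forall x : G, x \in w) /\
  forall u v : G, u != v -> (adj u v <-> L (hmor u v w)).

Definition graph_class (L : language) (G : graph) : Prop :=
  exists w : seq G, is_word_graph L w.

(* Main.v *)
Require Import Defs.
From mathcomp Require Import all_boot all_order.

(** Since |h_{u,v}(w)| is the sum of the numbers of occurrences of u and v in w,
    the letters occurring an odd, resp. even, number of times span no edge.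
    Conversely, for parts A and B, start w with A^3 B^2, and append
    (a (B \ b))^4 for each non-adjacent pair (a,b) and (a B)^4 for each adjacent
    one.  The projection of w to a in A and b in B then starts with 0001.  If a
    and b are adjacent, every later 0 is followed by a 1, so 000 occurs only
    once, even cyclically, and the projection is a Lyndon word.  Otherwise it
    contains 0000, so that some conjugate is smaller. *)

Set Implicit Arguments.
Unset Strict Implicit.
Unset Printing Implicit Defensive.

(** * Lexicographic order, conjugates and Lyndon words *)

Lemma lexle_cons (x y : bool) (s t : bword) :
  lexle (x :: s) (y :: t) = (x ==> y) && ((y ==> x) ==> lexle s t).
Proof. by rewrite /lexle Order.SeqLexiOrder.lexi_cons; case: x; case: y. Qed.

Lemma lexle_total : total lexle.
Proof. by move=> s t; apply: (@Order.TotalTheory.le_total _ (seqlexi bool)). Qed.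

(** The word 0^n is the least word of length n. The bound on the sizes excludes that [s] is a proper
    prefix of 0^n. *)
Lemma prefix_zeros_lexle n (s t : bword) : size t <= size s -> lexle s t ->
  prefix (nseq n false) t -> prefix (nseq n false) s.
Proof.
elim: n s t => [|n IHn] [|x s] [|y t] //; rewrite lexle_cons /= => sz_ts.
case/andP=> xy le_st; case: y => //= in xy le_st *.
by case: x xy le_st => //= _; apply: IHn.
Qed.

Lemma conjugate_rot i (s : bword) : conjugate s (rot i s).
Proof. by exists (take i s), (drop i s); rewrite cat_take_drop. Qed.

Lemma conjugateP (s t : bword) : conjugate s t ->
  t = s \/ exists2 i, 0 < i < size s & t = rot i s.
Proof.
case=> u [v [-> ->]]; case: u => [|x u]; first by rewrite cats0; left.
case: v => [|y v]; first by rewrite cats0; left.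
right; exists (size (x :: u)); last by rewrite rot_size_cat.
by rewrite size_cat /= addnS ltnS ltnS leq_addr.
Qed.

(** A conjugate that is at most [s] would also have to begin with 0^n, and a power of [u] is fixed
    by the rotation by |u|, which would then begin with 0^n. *)
Lemma lyndon_zeros n (s : bword) : prefix (nseq n false) s -> s != [::] ->
  (forall i, 0 < i < size s -> ~~ prefix (nseq n false) (rot i s)) -> lyndon s.
Proof.
move=> s0n s_neq0 rotN; split.
  case=> u [[|[|k]] [//= _ def_s]].
  have u_gt0: 0 < size u.
    rewrite lt0n; apply: contra s_neq0 => /nilP u0.
    by rewrite def_s u0; elim: k {def_s}.
  have lt_us: size u < size s.
    by rewrite def_s !size_cat -{1}[size u]addn0 ltn_add2l addn_gt0 u_gt0.
  have /negP[] := rotN (size u) (introT andP (conj u_gt0 lt_us)).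
  suff ->: rot (size u) s = s by [].
  rewrite def_s rot_size_cat -catA; congr (_ ++ _).
  by elim: k {def_s} => [|k IHk] /=; rewrite ?cats0 // -catA IHk.
move=> t /conjugateP[->|[i lt_is ->]]; first by case/orP: (lexle_total s s).
case/orP: (lexle_total s (rot i s)) => // le_rot.
have /negP[] := rotN i lt_is.
by apply: prefix_zeros_lexle le_rot s0n; rewrite size_rot.
Qed.

(** Rotating the inner factor 0^n to the front gives a smaller conjugate. *)
Lemma lyndon_zerosN n (s t : bword) :
  ~~ prefix (nseq n false) (s ++ nseq n false ++ t) ->
  ~ lyndon (s ++ nseq n false ++ t).
Proof.
move=> s0n [_ /(_ _ (conjugate_rot (size s) _)) le_s]; case/negP: s0n.
apply: prefix_zeros_lexle le_s _; first by rewrite size_rot.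
by rewrite rot_size_cat -catA prefix_prefix.
Qed.

Lemma lyndon_head (s : bword) : false \in s -> lyndon s -> ohead s = Some false.
Proof.
case/splitPr=> s1 s2 lyn; have := @lyndon_zerosN 1 s1 s2.
by case: s1 lyn => [|[] s1] //= lyn /(_ isT).
Qed.

(* Membership in {1,01}^*. *)
Definition zeros_followed (s : bword) := path orb true s && last true s.

(** After [s] the last letter is again 1, the start value of [path], so the junction imposes no
    condition on [t]. *)
Lemma zeros_followed_cat (s t : bword) :
  zeros_followed s -> zeros_followed t -> zeros_followed (s ++ t).
Proof.
rewrite /zeros_followed cat_path last_cat => /andP[-> ls].
by case: (last true s) ls.
Qed.

Lemma zeros_followed_flatten (ss : seq bword) :
  all zeros_followed ss -> zeros_followed (flatten ss).
Proof.
by elim: ss => //= s ss IHs /andP[zs /IHs]; apply: zeros_followed_cat.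
Qed.

(** Since [s] ends in 1, a 0 at position i has its following 1 still inside [s], whatever [t] is. *)
Lemma prefix_zeros_drop i (s t : bword) : zeros_followed s -> i < size s ->
  ~~ prefix [:: false; false] (drop i s ++ t).
Proof.
rewrite -{1}(cat_take_drop i s) => + lt_is.
have : size (drop i s) != 0 by rewrite size_drop subn_eq0 -ltnNge.
rewrite /zeros_followed cat_path last_cat.
by case: (drop i s) => [|[] [|[] v]] //= _; rewrite !(orbF, andbF).
Qed.

Lemma lyndon_zeros_followed (s : bword) :
  zeros_followed s -> lyndon [:: false, false, false, true & s].
Proof.
move=> zs; apply: (@lyndon_zeros 3) => // -[|[|[|i]]] //= lt_i.
have lt_is : i < size (true :: s) by [].
rewrite /rot /=.
(* The rotations by 1 and 2 begin with 001 and 01. A leading 1 leaves [zeros_followed] unchanged up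
   to conversion, so [zs] serves for [true :: s]. *)
have := @prefix_zeros_drop i (true :: s) (take i.+3 [:: false, false, false, true & s]) zs lt_is.
apply: contra => /=; case: (drop i (true :: s) ++ _) => [|x [|y [|z u]]] //=.
  by case: x y => [] [].
by case: x y => [] [].
Qed.

(** * Projections to two letters *)

Section Projection.

Variables (V : eqType).
Implicit Types (u v x : V) (s t : seq V) (ss : seq (seq V)).

Lemma hmorE u v s : hmor u v s = [seq x != u | x <- s & (x == u) || (x == v)].
Proof.
elim: s => //= x s IHs; rewrite [LHS]/(_ ++ hmor u v s) {}IHs.
by case: (eqVneq x u) => [-> | xu] /=; [rewrite eqxx | case: ifP => //= _; rewrite xu].
Qed.

Lemma hmor_cat u v s t : hmor u v (s ++ t) = hmor u v s ++ hmor u v t.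
Proof. by rewrite /hmor map_cat flatten_cat. Qed.

Lemma hmor_flatten u v ss : hmor u v (flatten ss) = flatten (map (hmor u v) ss).
Proof. by elim: ss => //= s ss IHss; rewrite hmor_cat IHss. Qed.

Lemma hmor_swap u v s : u != v -> hmor v u s = swap01 (hmor u v s).
Proof.
move=> uv; rewrite !hmorE /swap01 -map_comp.
under eq_filter do rewrite orbC.
apply/eq_in_map => x; rewrite mem_filter => /andP[xuv _] /=.
rewrite negbK; case/orP: xuv => /eqP->; first by rewrite eqxx.
by rewrite eqxx (negPf (_ : v != u)) // eq_sym.
Qed.

Lemma odd_size_hmor u v s : u != v ->
  odd (size (hmor u v s)) = odd (count_mem u s) (+) odd (count_mem v s).
Proof.
move=> uv; rewrite hmorE size_map size_filter -oddD -count_predUI.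
(* The correction term counts letters equal to both [u] and [v]. *)
rewrite [X in _ = odd (_ + X)](_ : _ = 0) ?addn0 //.
apply/eqP; rewrite -leqn0 leqNgt -has_count; apply/hasPn => x _ /=.
by case: (eqVneq x u) => // ->.
Qed.

Lemma hmor_notin u v s : u \notin s -> v \notin s -> hmor u v s = [::].
Proof.
move=> us vs; rewrite hmorE.
rewrite (@eq_in_filter _ _ pred0) ?filter_pred0 // => x xs.
by rewrite (negPf (memPn us _ xs)) (negPf (memPn vs _ xs)).
Qed.

Lemma hmor_uniq_l u v s :
  uniq s -> u \in s -> v \notin s -> hmor u v s = [:: false].
Proof.
move=> Us us vs; rewrite hmorE (@eq_in_filter _ _ (pred1 u)) => [|x xs].
  by rewrite filter_pred1_uniq //= eqxx.
by rewrite (negPf (memPn vs _ xs)) orbF.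
Qed.

Lemma hmor_uniq_r u v s :
  uniq s -> u \notin s -> v \in s -> hmor u v s = [:: true].
Proof.
move=> Us us vs; rewrite hmorE (@eq_in_filter _ _ (pred1 v)) => [|x xs].
  by rewrite filter_pred1_uniq //= (memPn us).
by rewrite (negPf (memPn us _ xs)).
Qed.

End Projection.

(** * The word of a bipartite graph *)

Definition seq_pow (T : Type) k (s : seq T) := flatten (nseq k s).

Lemma count_seq_pow (T : Type) (p : pred T) k s :
  count p (seq_pow k s) = k * count p s.
Proof. by elim: k => //= k IHk; rewrite count_cat -/(seq_pow k s) IHk. Qed.

Lemma odd_count_flatten (T : Type) (p : pred T) (ss : seq (seq T)) :
  all (fun s => ~~ odd (count p s)) ss -> ~~ odd (count p (flatten ss)).
Proof.
elim: ss => //= s ss IHss /andP[/negPf os /IHss].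
by rewrite count_cat oddD os.
Qed.

Section BipartiteWord.

Variables (G : graph) (A : {set G}).
Implicit Types a b u v : G.

(** The exponent 4 exceeds the 3 zeros at the start of a projection, and being even it preserves the
    parity of every letter count. *)
Definition gadget a b : seq G :=
  seq_pow 4 (a :: [seq x <- enum (~: A) | (x != b) || adj a b]).

Definition gadgets := [seq gadget a b | a <- enum A, b <- enum (~: A)].

(** The exponents 3 and 2 make the letters of [A] odd and all others even. *)
Definition bipartite_word : seq G :=
  seq_pow 3 (enum A) ++ seq_pow 2 (enum (~: A)) ++ flatten gadgets.

Lemma mem_bipartite_word u : u \in bipartite_word.
Proof.
rewrite /bipartite_word !mem_cat !mem_enum in_setC.
by case: (u \in A); rewrite ?orbT.
Qed.

Lemma odd_count_bipartite_word u : odd (count_mem u bipartite_word) = (u \in A).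
Proof.
rewrite count_cat count_seq_pow oddD oddM count_cat count_seq_pow oddD oddM /=.
rewrite (negPf (odd_count_flatten _)) ?addbF.
  by rewrite count_uniq_mem ?enum_uniq // mem_enum; case: (u \in A).
by apply/allP => _ /allpairsP[ab [_ _ ->]]; rewrite count_seq_pow oddM.
Qed.

Lemma hmor_bipartite_word a b : a \in A -> b \notin A ->
  hmor a b bipartite_word
    = [:: false, false, false, true, true & hmor a b (flatten gadgets)].
Proof.
move=> aA bA; rewrite /bipartite_word /seq_pow hmor_cat hmor_flatten hmor_cat (hmor_flatten _ _ (nseq 2 _)) !map_nseq.
by rewrite hmor_uniq_l ?(@hmor_uniq_r _ _ _ (enum (~: A))) ?enum_uniq ?mem_enum ?in_setC ?aA ?bA.
Qed.

Lemma hmor_gadget_rest a b a' b' : a \in A -> b \notin A ->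
  hmor a b [seq x <- enum (~: A) | (x != b') || adj a' b']
    = if (b != b') || adj a' b' then [:: true] else [::].
Proof.
move=> aA bA; case: ifP => bb'.
  rewrite hmor_uniq_r ?(filter_uniq _ (enum_uniq _)) // mem_filter mem_enum in_setC.
    by rewrite aA andbF.
  by rewrite bb'.
by rewrite hmor_notin // mem_filter mem_enum in_setC ?aA ?andbF ?bb'.
Qed.

Lemma hmor_gadget a b a' b' : a \in A -> b \notin A -> a' \in A ->
  hmor a b (gadget a' b') =
    seq_pow 4 ((if a' == a then [:: false] else [::]) ++
               (if (b != b') || adj a' b' then [:: true] else [::])).
Proof.
move=> aA bA a'A; rewrite /gadget /seq_pow hmor_flatten map_nseq; congr flatten.
congr nseq; rewrite -cat1s hmor_cat hmor_gadget_rest //; congr (_ ++ _).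
rewrite /hmor /= cats0; case: eqP => // _.
by rewrite (negPf (_ : a' != b)) //; apply: contraNneq bA => <-.
Qed.

Lemma lyndon_bipartite_word a b : a \in A -> b \notin A ->
  adj a b -> lyndon (hmor a b bipartite_word).
Proof.
move=> aA bA ab; rewrite hmor_bipartite_word //.
(* The second 1 of the initial 00011 goes to the tail as a factor of its own. *)
apply: lyndon_zeros_followed; apply: (@zeros_followed_cat [:: true]) => //.
rewrite hmor_flatten; apply: zeros_followed_flatten; rewrite all_map.
apply/allP => _ /allpairsP[[a' b'] [/= + _ ->]]; rewrite mem_enum /= => a'A.
(* For a' = a every block projects to 01, because [b] could be missing only for b' = b, where the
   edge keeps it. Otherwise blocks project to 1 or to the empty word. *)
rewrite hmor_gadget //; case: (eqVneq a' a) => [->|_]; last by case: ifP.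
by case: (eqVneq b b') => [<-|_]; rewrite ?ab.
Qed.

Lemma lyndon_bipartite_wordN a b : a \in A -> b \notin A ->
  ~~ adj a b -> ~ lyndon (hmor a b bipartite_word).
Proof.
move=> aA bA abN.
have: gadget a b \in gadgets by apply: allpairs_f; rewrite mem_enum ?in_setC.
rewrite hmor_bipartite_word //; case/splitPr => s t.
rewrite flatten_cat hmor_cat [flatten (_ :: _)]/= (hmor_cat _ _ (gadget a b)).
rewrite hmor_gadget // !eqxx (negPf abN) /=.
exact: (@lyndon_zerosN 4 [:: false, false, false, true, true & _]).
Qed.

(** The exchanged word begins with 1 but contains a 0. *)
Lemma lyndon_swap_bipartite_wordN a b : a \in A -> b \notin A ->
  ~ lyndon (swap01 (hmor a b bipartite_word)).
Proof.
by move=> aA bA; rewrite hmor_bipartite_word //= => lyn; have := lyndon_head _ lyn; move/(_ isT).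
Qed.

Lemma bipartite_word_adj a b : a \in A -> b \notin A ->
  adj a b <-> odd_part lyndon_lang (hmor a b bipartite_word).
Proof.
move=> aA bA; have ab : a != b by apply: contraNneq bA => <-.
rewrite /odd_part odd_size_hmor // !odd_count_bipartite_word aA (negPf bA).
split=> [adj_ab | [[lyn | /lyndon_swap_bipartite_wordN[] //] _]].
  by split=> //; left; apply: lyndon_bipartite_word.
by apply/negPn/negP => /lyndon_bipartite_wordN[].
Qed.

Lemma bipartite_word_graph : no_edge_in A -> no_edge_in (~: A) ->
  is_word_graph (odd_part lyndon_lang) bipartite_word.
Proof.
move=> noA noAC; split=> [|u v uv]; first exact: mem_bipartite_word.
have [uA|uA] := boolP (u \in A); have [vA|vA] := boolP (v \in A).
- rewrite (negPf (noA u v uA vA)); split=> // -[_].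
  by rewrite odd_size_hmor // !odd_count_bipartite_word uA vA.
- exact: bipartite_word_adj.
(* Here [v] is the letter in [A], so the projection is read with the roles of 0 and 1 exchanged. *)
- rewrite adj_sym hmor_swap 1?eq_sym //.
  exact: iff_trans (bipartite_word_adj vA uA) (sym01_odd_lyndon _).
- rewrite (negPf (noAC u v _ _)) ?in_setC //; split=> // -[_].
  by rewrite odd_size_hmor // !odd_count_bipartite_word (negPf uA) (negPf vA).
Qed.

End BipartiteWord.

(** * From words to bipartitions, and the equivalence *)

(** Two letters whose counts have equal parity project to a word of even length. *)
Lemma no_edge_in_parity (G : graph) (L : language) (w : seq G) (c : bool) :
  is_word_graph (odd_part L) w ->
  no_edge_in [set x : G | odd (count_mem x w) == c].
Proof.
move=> [_ adjP] u v; rewrite !inE => /eqP uc /eqP vc.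
have [->|uv] := eqVneq u v; first by rewrite adj_irrefl.
by apply/negP => /(adjP u v uv)[_]; rewrite odd_size_hmor // uc vc addbb.
Qed.

Theorem theorem26 (G : graph) :
  graph_class (odd_part lyndon_lang) G <-> bipartite G.
Proof.
split=> [[w wP] | [A [B [AB dAB noA noB]]]].
  pose part c := [set x : G | odd (count_mem x w) == c].
  exists (part true), (part false); split; try exact: no_edge_in_parity wP.
    by apply/setP => x; rewrite !inE; case: odd.
  by apply/pred0P => x; rewrite /= !inE; case: odd.
have def_B : B = ~: A.
  apply/setP => x; rewrite in_setC; have := in_setT x; rewrite -AB in_setU.
  by have [/(disjointFr dAB)->|] := boolP (x \in A).
by exists (bipartite_word A); apply: bipartite_word_graph; rewrite -?def_B.
Qed.
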